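(* Let $\varphi\in\mathsf{LTL_f}(\mathcal{P})$ with $\mathcal{P}=\mathcal{P}_o\uplus\mathcal{P}_u$, and let $\mathcal{A}^B_\varphi$ be the belief-state DFA of $\varphi$. Then for every observable word $\sigma_o\in(\mathbb{B}^{\mathcal{P}_o})^{+}$: $\sigma_o\in\mathscr{L}(\mathcal{A}^B_\varphi)$ if and only if every word $\sigma\in(\mathbb{B}^{\mathcal{P}})^{+}$ with $\sigma|_{\mathcal{P}_o}=\sigma_o$ satisfies $\sigma,0\models\varphi$.
   Context: $\mathbb{B}=\{\bot,\top\}$; assignments $w:\mathcal{P}\to\mathbb{B}$ (identified with the set of true propositions); $w_1\sqcup w_2$ combines assignments over disjoint sets; $\sigma|_{\mathcal{P}_o}$ restricts each letter to $\mathcal{P}_o$. A finite word of length $n$ is a map $\{0,\dots,n-1\}\to\mathbb{B}^{\mathcal{P}}$. $\mathsf{LTL_f}(\mathcal{P})$ formulas: $\varphi::=\mathit{tt}\mid\mathit{ff}\mid p\mid\neg\varphi\mid\varphi\odot\varphi\mid \mathsf{X}\varphi\mid\mathsf{X}^{s}\varphi\mid\mathsf{F}\varphi\mid\mathsf{G}\varphi\mid\varphi\,\mathsf{U}\,\varphi\mid\varphi\,\mathsf{R}\,\varphi$. Semantics for $\sigma$ of length $n$, $0\le i<n$: $\sigma,i\models\mathit{tt}$ iff $i<n$; $\sigma,i\models\mathit{ff}$ iff $i=n$; $\sigma,i\models p$ iff $p\in\sigma(i)$; Boolean connectives as usual; $\mathsf{X}\varphi$: $i+1=n$ or $\sigma,i+1\models\varphi$;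 $\mathsf{X}^s\varphi$: $i+1<n$ and $\sigma,i+1\models\varphi$; $\mathsf{F}\varphi$: $\exists j\in[i,n)$, $\sigma,j\models\varphi$; $\mathsf{G}\varphi$: $\forall j\in[i,n)$, $\sigma,j\models\varphi$; $\varphi_1\mathsf{U}\varphi_2$: $\exists j\in[i,n)$ with $\sigma,j\models\varphi_2$ and $\forall k\in[i,j)$, $\sigma,k\models\varphi_1$; $\varphi_1\mathsf{R}\varphi_2$: $\forall j\in[i,n)$, $\sigma,j\models\varphi_2$ or $\exists k\in[i,j)$, $\sigma,k\models\varphi_1$. Propositional equivalence $\sim$: replace each maximal temporal subformula $\psi$ by a fresh Boolean variable $x_\psi$, and compare the resulting Boolean formulas semantically. $[\varphi]_\sim$ is a fixed unique representative of the $\sim$-class. Pairs: $(\varphi_1,b_1)\odot(\varphi_2,b_2)=([\varphi_1\odot\varphi_2]_\sim,b_1\odot b_2)$, $\neg(\varphi,b)=([\neg\varphi]_\sim,\neg b)$, $\bigwedge X=(\bigwedge_{(\varphi,b)\in X}\varphi,\bigwedge_{(\varphi,b)\in X}b)$. Formula progression $\mathrm{fp}(\varphi,w)\in\mathsf{LTL_f}(\mathcal{P})\times\mathbb{B}$: $\mathrm{fp}(\mathit{tt},w)=(\mathit{tt},\top)$, $\mathrm{fp}(\mathit{ff},w)=(\mathit{ff},\bot)$; $\mathrm{fp}(p,w)=(\mathit{tt},\top)$ if $p\in w$, else $(\mathit{ff},\bot)$; $\mathrm{fp}(\neg\varphi,w)=\neg\mathrm{fp}(\varphi,w)$; $\mathrm{fp}(\varphi_1\odot\varphi_2,w)=\mathrm{fp}(\varphi_1,w)\odot\mathrm{fp}(\varphi_2,w)$;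 $\mathrm{fp}(\mathsf{X}\varphi,w)=(\varphi,\top)$; $\mathrm{fp}(\mathsf{X}^s\varphi,w)=(\varphi,\bot)$; $\mathrm{fp}(\mathsf{F}\varphi,w)=\mathrm{fp}(\varphi,w)\vee(\mathsf{F}\varphi,\bot)$; $\mathrm{fp}(\mathsf{G}\varphi,w)=\mathrm{fp}(\varphi,w)\wedge(\mathsf{G}\varphi,\top)$; $\mathrm{fp}(\varphi_1\mathsf{U}\varphi_2,w)=\mathrm{fp}(\varphi_2,w)\vee(\mathrm{fp}(\varphi_1,w)\wedge(\varphi_1\mathsf{U}\varphi_2,\bot))$; $\mathrm{fp}(\varphi_1\mathsf{R}\varphi_2,w)=\mathrm{fp}(\varphi_2,w)\wedge(\mathrm{fp}(\varphi_1,w)\vee(\varphi_1\mathsf{R}\varphi_2,\top))$. Observable progression: $\mathrm{fp}_{\mathrm{obs}}(\psi,w_o)=\bigwedge\{\mathrm{fp}(\psi,w)\mid w\in\mathbb{B}^{\mathcal{P}},\ w|_{\mathcal{P}_o}=w_o\}$, extended to words by $\mathrm{fp}_{\mathrm{obs}}(\varphi,\sigma_o\cdot w_o)=\mathrm{fp}_{\mathrm{obs}}(\psi,w_o)$ where $\psi$ is the first component of $\mathrm{fp}_{\mathrm{obs}}(\varphi,\sigma_o)$. Belief-state DFA $\mathcal{A}^B_\varphi=\langle\mathcal{S},\mathbb{B}^{\mathcal{P}_o},\iota^B,\delta^B,\mathcal{T}^B\rangle$: $\mathcal{S}=\{[\varphi]_\sim\}\cup\{[\psi']_\sim\mid(\psi',\_)=\mathrm{fp}_{\mathrm{obs}}(\varphi,\sigma_o),\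 \sigma_o\in(\mathbb{B}^{\mathcal{P}_o})^+\}$; $\iota^B=[\varphi]_\sim$; $\delta^B(s,w_o)=s'$ where $(s',\_)=\mathrm{fp}_{\mathrm{obs}}(s,w_o)$; accepting transitions $\mathcal{T}^B=\{(s,w_o)\mid(\_,\top)=\mathrm{fp}_{\mathrm{obs}}(s,w_o)\}$. A word $w_o^0\cdots w_o^{n-1}$ ($n\ge1$) with run $s_0=\iota^B$, $s_{t+1}=\delta^B(s_t,w_o^t)$ is accepted (in $\mathscr{L}(\mathcal{A}^B_\varphi)$) iff its last transition $(s_{n-1},w_o^{n-1})\in\mathcal{T}^B$. *)

(* Defs.v *)
From HB Require Import structures.
From mathcomp Require Import all_boot.

Set Implicit Arguments.
Unset Strict Implicit.
Unset Printing Implicit Defensive.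

(** Syntax and semantics of LTLf *)

Definition assignment (T : finType) := {ffun T -> bool}.

Definition connective := {ffun bool * bool -> bool}.
Definition conj_c : connective := [ffun b => b.1 && b.2].
Definition disj_c : connective := [ffun b => b.1 || b.2].

Inductive ltlf (P : finType) : Type :=
| Tt
| Ff
| Var of P
| Not of ltlf P
| Bin of connective & ltlf P & ltlf P
| WNext of ltlf P
| SNext of ltlf P
| Eventually of ltlf P
| Always of ltlf P
| Until of ltlf P & ltlf P
| Release of ltlf P & ltlf P.

Arguments Tt {P}.
Arguments Ff {P}.

(** A word is the sequence of its letters.  Only positions [i < size sigma]
    are meaningful: the default letter of [nth] is never read from them. *)
Fixpoint sat (P : finType) (sigma : seq (assignment P)) (i : nat)
    (phi : ltlf P) {struct phi} : bool :=
  let n := size sigma in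
  match phi with
  | Tt => i < n
  | Ff => i == n
  | Var p => nth [ffun=> false] sigma i p
  | Not f => ~~ sat sigma i f
  | Bin c f g => c (sat sigma i f, sat sigma i g)
  | WNext f => (i.+1 == n) || sat sigma i.+1 f
  | SNext f => (i.+1 < n) && sat sigma i.+1 f
  | Eventually f => [exists j : 'I_n, (i <= j) && sat sigma j f]
  | Always f => [forall j : 'I_n, (i <= j) ==> sat sigma j f]
  | Until f g =>
      [exists j : 'I_n, [&& i <= j, sat sigma j g &
        [forall k : 'I_n, (i <= k < j) ==> sat sigma k f]]]
  | Release f g =>
      [forall j : 'I_n, (i <= j) ==>
        (sat sigma j g || [exists k : 'I_n, (i <= k < j) && sat sigma k f])]
  end.

(** Propositional equivalence *)

(** [v psi] is the value of the fresh variable standing for the temporal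
    formula [psi]; the recursion stops at temporal operators, so exactly the
    maximal temporal subformulas are replaced. *)
Fixpoint peval (P : finType) (u : assignment P) (v : ltlf P -> bool)
    (phi : ltlf P) : bool :=
  match phi with
  | Tt => true
  | Ff => false
  | Var p => u p
  | Not f => ~~ peval u v f
  | Bin c f g => c (peval u v f, peval u v g)
  | _ => v phi
  end.

Definition prop_equiv (P : finType) (f g : ltlf P) : Prop :=
  forall u v, peval u v f = peval u v g.

Record class_repr (P : finType) := ClassRepr {
  repr :> ltlf P -> ltlf P;
  repr_equiv : forall f, prop_equiv (repr f) f;
  repr_unique : forall f g, prop_equiv f g -> repr f = repr g }.

(** Formula progression *)

Section Progression.
Variables (P : finType) (r : class_repr P).

Definition pair_not (x : ltlf P * bool) : ltlf P * bool :=
  (r (Not x.1), ~~ x.2).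

Definition pair_bin (c : connective) (x y : ltlf P * bool) : ltlf P * bool :=
  (r (Bin c x.1 y.1), c (x.2, y.2)).

(** A finite set of pairs is given by a list of its elements; order and
    repetitions only matter up to [prop_equiv].  As opposed to the operations
    above, no representative is taken. *)
Definition pair_bigand (X : seq (ltlf P * bool)) : ltlf P * bool :=
  (foldr (Bin conj_c) Tt [seq x.1 | x <- X], all snd X).

Fixpoint fp (phi : ltlf P) (w : assignment P) : ltlf P * bool :=
  match phi with
  | Tt => (Tt, true)
  | Ff => (Ff, false)
  | Var p => if w p then (Tt, true) else (Ff, false)
  | Not f => pair_not (fp f w)
  | Bin c f g => pair_bin c (fp f w) (fp g w)
  | WNext f => (f, true)
  | SNext f => (f, false)
  | Eventually f => pair_bin disj_c (fp f w) (phi, false)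
  | Always f => pair_bin conj_c (fp f w) (phi, true)
  | Until f g =>
      pair_bin disj_c (fp g w) (pair_bin conj_c (fp f w) (phi, false))
  | Release f g =>
      pair_bin conj_c (fp g w) (pair_bin disj_c (fp f w) (phi, true))
  end.

Variable Po : {set P}.

Definition obs := assignment {p : P | p \in Po}.

Definition restrict (w : assignment P) : obs := [ffun p => w (val p)].

Definition fp_obs (psi : ltlf P) (wo : obs) : ltlf P * bool :=
  pair_bigand [seq fp psi w | w <- enum {: assignment P} & restrict w == wo].

(** The progression over the nonempty observable word [wo :: so]. *)
Definition fp_obs_word (phi : ltlf P) (wo : obs) (so : seq obs) :=
  foldl (fun x a => fp_obs x.1 a) (fp_obs phi wo) so.

Lemma peval_fp u v w phi :
  peval u v (fp phi w).1 = peval w (fun psi => peval u v (fp psi w).1) phi.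
Proof.
elim: phi => //= [p|f <-|c f <- g <-]; first by case: (w p).
- exact: (repr_equiv r (Not _)).
- exact: (repr_equiv r (Bin _ _ _)).
Qed.

Lemma fp_obs_equiv f g wo :
  prop_equiv f g -> prop_equiv (fp_obs f wo).1 (fp_obs g wo).1.
Proof.
move=> fg u v; rewrite /fp_obs /=; elim: filter => //= w s ->.
by rewrite !peval_fp fg.
Qed.

End Progression.

(** Deterministic automata with accepting transitions; finiteness of the state
    space is not recorded, as acceptance does not depend on it. *)

Record det_automaton (A : Type) := DetAutomaton {
  state : Type;
  init : state;
  delta : state -> A -> state;
  accepting : state -> A -> bool }.

Definition run (A : Type) (M : det_automaton A) (s : seq A) : state M :=
  foldl (@delta A M) (init M) s.

(** A nonempty word is accepted iff the last transition of its run is. *)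
Definition in_lang (A : Type) (M : det_automaton A) (s : seq A) : Prop :=
  exists t a, s = rcons t a /\ accepting (run M t) a.

Section BeliefDFA.
Variables (P : finType) (r : class_repr P) (Po : {set P}) (phi : ltlf P).

Definition is_belief_state (s : ltlf P) : Prop :=
  s = r phi \/
  exists (wo : obs Po) (so : seq (obs Po)), s = r (fp_obs_word r phi wo so).1.

Definition belief_state := {s : ltlf P | is_belief_state s}.

Definition belief_init : belief_state := exist _ (r phi) (or_introl erefl).

Lemma belief_delta_subproof (s : belief_state) (wo : obs Po) :
  is_belief_state (r (fp_obs r (sval s) wo).1).
Proof.
case: s => s /= [->|[w0 [so ->]]]; right.
- exists wo, [::]; apply/repr_unique/fp_obs_equiv; exact: repr_equiv.
- exists w0, (rcons so wo); rewrite /fp_obs_word foldl_rcons.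
  apply/repr_unique/fp_obs_equiv; exact: repr_equiv.
Qed.

(** States are representatives whereas [fp_obs] does not return one, hence the
    application of [r] to its first component. *)
Definition belief_delta (s : belief_state) (wo : obs Po) : belief_state :=
  exist _ (r (fp_obs r (sval s) wo).1) (belief_delta_subproof s wo).

Definition belief_accepting (s : belief_state) (wo : obs Po) : bool :=
  (fp_obs r (sval s) wo).2.

Definition belief_dfa : det_automaton (obs Po) :=
  DetAutomaton belief_init belief_delta belief_accepting.

End BeliefDFA.

(* Main.v *)
Require Import Defs.
From HB Require Import structures.
From mathcomp Require Import all_boot.

(** A letter [w] can be consumed by progression: [w :: s] satisfies [phi] iff the
    tail [s] satisfies the first component of [fp phi w] or, when [s] is empty
    and there is no position left to evaluate a formula at, iff the second
    component is true.  Since [fp_obs] is the conjunction of the progressions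
    over all letters compatible with an observation, the belief state reached
    after a prefix holds on a tail iff [phi] holds on all the words that extend
    the tail by a prefix with the same observation.  At a position inside a
    word, satisfaction is a propositional valuation, so passing to class
    representatives is harmless. *)

Lemma exists_ordS n (Q : pred 'I_n.+1) :
  [exists j, Q j] = Q ord0 || [exists j : 'I_n, Q (lift ord0 j)].
Proof.
apply/existsP/orP => [[j]|[|/existsP[j]]].
- by case: (unliftP ord0 j) => [k ->|-> ->]; [right; apply/existsP; exists k|left].
- by exists ord0.
- by exists (lift ord0 j).
Qed.

Lemma forall_ordS n (Q : pred 'I_n.+1) :
  [forall j, Q j] = Q ord0 && [forall j : 'I_n, Q (lift ord0 j)].
Proof.
apply: negb_inj; rewrite negb_and !negb_forall.
exact: (exists_ordS n (fun j => ~~ Q j)).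
Qed.

Lemma bump0 i : bump 0 i = i.+1.
Proof. by []. Qed.

Section Semantics.
Variable P : finType.
Implicit Types (w : assignment P) (s : seq (assignment P)) (f g : ltlf P).

(** No operator looks back: in every quantifier the bound [i.+1 <= j] excludes the new index 0, and
    the other indices shift. *)
Lemma sat_consS w s i f : sat (w :: s) i.+1 f = sat s i f.
Proof.
elim: f i => //= [f IH|c f IHf g IHg|f IH|f IH|f IH|f IH|f IHf g IHg|f IHf g IHg] i.
- by rewrite IH.
- by rewrite IHf IHg.
- by rewrite IH eqSS.
- by rewrite IH ltnS.
- by rewrite exists_ordS /=; apply: eq_existsb => j; rewrite bump0 ltnS IH.
- by rewrite forall_ordS /=; apply: eq_forallb => j; rewrite bump0 ltnS IH.
- rewrite exists_ordS /=; apply: eq_existsb => j; rewrite bump0 ltnS IHg.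
  congr [&& _, _ & _]; rewrite forall_ordS /=.
  by apply: eq_forallb => k; rewrite bump0 !ltnS IHf.
- rewrite forall_ordS /=; apply: eq_forallb => j; rewrite bump0 ltnS IHg.
  congr (_ ==> (_ || _)); rewrite exists_ordS /=.
  by apply: eq_existsb => k; rewrite bump0 !ltnS IHf.
Qed.

(** Expansion law matching the clause of [fp]. It covers empty [s] too, where the last disjunct is
    false. *)
Lemma sat_cons_eventually w s f :
  sat (w :: s) 0 (Eventually f) = sat (w :: s) 0 f || sat s 0 (Eventually f).
Proof.
rewrite /= exists_ordS /=; congr (_ || _).
by apply: eq_existsb => j; rewrite bump0 sat_consS.
Qed.

Lemma sat_cons_always w s f :
  sat (w :: s) 0 (Always f) = sat (w :: s) 0 f && sat s 0 (Always f).
Proof.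
rewrite /= forall_ordS /=; congr (_ && _).
by apply: eq_forallb => j; rewrite bump0 sat_consS.
Qed.

Lemma sat_cons_until w s f g :
  sat (w :: s) 0 (Until f g) =
  sat (w :: s) 0 g || (sat (w :: s) 0 f && sat s 0 (Until f g)).
Proof.
rewrite /= exists_ordS /=; congr (_ || _).
  by rewrite andb_idr // => _; apply/forallP.
have eq_body (j : 'I_(size s)) :
    [forall k : 'I_(size s).+1, (k < lift ord0 j) ==> sat (w :: s) k f] =
    sat (w :: s) 0 f && [forall k : 'I_(size s), (k < j) ==> sat s k f].
  rewrite forall_ordS /= bump0; congr (_ && _).
  by apply: eq_forallb => k; rewrite bump0 ltnS sat_consS.
(* The demand on [f] at position 0 does not depend on [j], so it can leave the quantifier. *)
transitivity [exists j : 'I_(size s), sat (w :: s) 0 f &&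
    (sat s j g && [forall k : 'I_(size s), (k < j) ==> sat s k f])].
  by apply: eq_existsb => j; rewrite eq_body bump0 sat_consS andbCA.
case: (sat (w :: s) 0 f) => //=.
by apply/existsP => -[].
Qed.

Lemma sat_cons_release w s f g :
  sat (w :: s) 0 (Release f g) =
  sat (w :: s) 0 g && (sat (w :: s) 0 f || sat s 0 (Release f g)).
Proof.
rewrite /= forall_ordS /=; congr (_ && _).
  by rewrite orb_idr // => /existsP[].
have eq_body (j : 'I_(size s)) :
    [exists k : 'I_(size s).+1, (k < lift ord0 j) && sat (w :: s) k f] =
    sat (w :: s) 0 f || [exists k : 'I_(size s), (k < j) && sat s k f].
  rewrite exists_ordS /= bump0; congr (_ || _).
  by apply: eq_existsb => k; rewrite bump0 ltnS sat_consS.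
transitivity [forall j : 'I_(size s), sat (w :: s) 0 f ||
    (sat s j g || [exists k : 'I_(size s), (k < j) && sat s k f])].
  by apply: eq_forallb => j; rewrite eq_body bump0 sat_consS orbCA.
case: (sat (w :: s) 0 f) => //=.
by apply/forallP.
Qed.

(* Fails at the end of the word, where [sat] makes [Tt] false and [Ff] true. *)
Lemma sat_peval s i f : i < size s ->
  sat s i f = peval (nth [ffun=> false] s i) (sat s i) f.
Proof.
move=> ltis; elim: f => //= [|f ->|c f -> g ->] //.
by rewrite (ltn_eqF ltis).
Qed.

Lemma sat_equiv s i f g : i < size s -> prop_equiv f g -> sat s i f = sat s i g.
Proof. by move=> ltis fg; rewrite !(sat_peval s i) // fg. Qed.

End Semantics.

Section Correctness.
Variables (P : finType) (r : class_repr P).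
Implicit Types (w : assignment P) (s : seq (assignment P)) (f g : ltlf P).

(* Satisfaction of a progressed pair by the part of the word yet to be read. *)
Definition sat_pair s (x : ltlf P * bool) : bool :=
  if s is [::] then x.2 else sat s 0 x.1.

(** The leading letter matters: on the empty word equivalent formulas may differ. *)
Lemma sat_repr w s f : sat (w :: s) 0 (r f) = sat (w :: s) 0 f.
Proof. by apply: sat_equiv => //; exact: repr_equiv. Qed.

Lemma sat_pair_not s x : sat_pair s (pair_not r x) = ~~ sat_pair s x.
Proof. by case: s => //= w s; rewrite sat_repr. Qed.

Lemma sat_pair_bin s c x y :
  sat_pair s (pair_bin r c x y) = c (sat_pair s x, sat_pair s y).
Proof. by case: s => //= w s; rewrite sat_repr. Qed.

Lemma sat_pair_bigand s X : sat_pair s (pair_bigand X) = all (sat_pair s) X.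
Proof.
case: s => [|w s]; first exact: eq_all.
by elim: X => //= x X <-; rewrite ffunE.
Qed.

(* The flag records the value of a temporal formula at the end of the word. *)
Lemma sat_pair_id s f : sat_pair s (f, sat [::] 0 f) = sat s 0 f.
Proof. by case: s. Qed.

Lemma sat_fp w s f : sat (w :: s) 0 f = sat_pair s (fp r f w).
Proof.
(* A formula postponed to the tail must carry its value on the empty word as flag; [ex0] and [all0]
   compute that value. *)
have sat0 g b : sat [::] 0 g = b -> sat_pair s (g, b) = sat s 0 g.
  by move=> <-; exact: sat_pair_id.
have ex0 (Q : pred 'I_0) : [exists j, Q j] = false by apply/existsP => -[[]].
have all0 (Q : pred 'I_0) : [forall j, Q j] by apply/forallP => -[].
elim: f => [||p|f IH|c f IHf g IHg|f IH|f IH|f IH|f IH|f IHf g IHg|f IHf g IHg].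
- by case: s {sat0}.
- by case: s {sat0}.
- by rewrite /=; case: (w p); case: s {sat0}.
- by rewrite /= sat_pair_not IH.
- by rewrite /= sat_pair_bin IHf IHg.
- by rewrite /= sat_consS; case: s {sat0 IH}.
- by rewrite /= sat_consS; case: s {sat0 IH}.
- by rewrite sat_cons_eventually /= sat_pair_bin ffunE IH sat0 //=; exact: ex0.
- by rewrite sat_cons_always /= sat_pair_bin ffunE IH sat0 //=; exact: all0.
- rewrite sat_cons_until /= !sat_pair_bin !ffunE IHf IHg sat0 //=; exact: ex0.
- rewrite sat_cons_release /= !sat_pair_bin !ffunE IHf IHg sat0 //=; exact: all0.
Qed.

Lemma sat_fp_obs (Po : {set P}) s f (wo : obs Po) :
  reflect (forall w, restrict Po w = wo -> sat (w :: s) 0 f)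
          (sat_pair s (fp_obs r f wo)).
Proof.
rewrite sat_pair_bigand all_map; apply: (iffP allP) => [H w wwo|H w].
  by rewrite sat_fp; apply: H; rewrite mem_filter wwo eqxx mem_enum.
by rewrite mem_filter => /andP[/eqP wwo _] /=; rewrite -sat_fp; exact: H.
Qed.

(** The start state [q] is arbitrary for the induction: [sat_fp_obs] handles the first letter, the
    induction hypothesis the tail. *)
Lemma belief_accepts_from (Po : {set P}) (phi : ltlf P)
    (q : belief_state r Po phi) (so : seq (obs Po)) (a : obs Po) :
  belief_accepting (foldl (@belief_delta P r Po phi) q so) a <->
  (forall s, map (@restrict P Po) s = rcons so a -> sat s 0 (sval q)).
Proof.
elim: so q => [|wo so IH] q /=.
  (* With one observation left the tail is empty, and [sat_pair] reduces to the flag that decides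
     acceptance. *)
  split=> [acc [|w [|? ?]] //= [wa]|H].
    exact: (sat_fp_obs Po [::] (sval q) a acc).
  by apply/(sat_fp_obs Po [::] (sval q) a) => w wa; apply: H; rewrite /= wa.
apply: (iff_trans (IH _)); split=> [H [|w s] //= [wwo sE]|H [|w s] /= sE].
- have /= := H s sE; case: s sE {H} => [|w' s sE]; first by case: so {IH}.
  by rewrite sat_repr => /(sat_fp_obs Po (w' :: s)); exact.
- by case: so sE {IH H}.
- rewrite sat_repr; apply/(sat_fp_obs Po (w :: s)) => v vwo.
  by apply: H; rewrite /= vwo sE.
Qed.

End Correctness.

Theorem theorem1 (P : finType) (Po Pu : {set P})
    (cover_P : Po :|: Pu = [set: P]) (disj_P : [disjoint Po & Pu])
    (r : class_repr P) (phi : ltlf P)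
    (sigma_o : seq (obs Po)) (sigma_o_neq0 : sigma_o <> [::]) :
  in_lang (belief_dfa r Po phi) sigma_o <->
  (forall sigma : seq (assignment P), sigma <> [::] ->
     map (@restrict P Po) sigma = sigma_o -> sat sigma 0 phi).
Proof.
split=> [[so [a [-> acc]]] [|w s] // _ sE|].
  by rewrite -(sat_repr _ r); exact: (proj1 (belief_accepts_from _ _ _ _ _ _ _) acc _ sE).
case/lastP: sigma_o sigma_o_neq0 => // so a _ H.
exists so, a; split=> //; apply/belief_accepts_from => -[|w s] sE.
  by case: so sE {H}.
by rewrite sat_repr; exact: H.
Qed.
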